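(* Let $d\ge 1$, $p>1$ and $A>0$. Let $H=H(x,t,q)$ be a real-valued function on $B_1\times[0,1]\times\mathbb R^d$ such that for all $(x,t)\in B_1\times[0,1]$ and $q\in\mathbb R^d$, $$\frac1A|q|^p-A\le H(x,t,q)\le A|q|^p+A .$$ Let $u$ be a bounded continuous viscosity solution of $u_t+H(x,t,Du)=0$ in $B_1\times[0,1]$. Then $u$ is $C^\alpha$ (Hölder continuous in $(x,t)$) in $B_{1/2}\times[1/2,1]$, where $\alpha\in(0,1)$ and the $C^\alpha$ norm of $u$ on $B_{1/2}\times[1/2,1]$ are controlled by quantities depending only on $p$, $A$ and $\|u\|_{L^\infty}$ (and the dimension $d$).
   Context: $B_r\subset\mathbb R^d$ is the ball of radius $r$ centered at $0$; $Du$ is the spatial gradient. Viscosity solution convention ($H$ need not be continuous): a continuous function $u$ is a viscosity subsolution (resp. supersolution) of $u_t+H(x,t,Du)=0$ if for every smooth $\varphi$ and every interior point $(x_0,t_0)$ of the domain at which $u-\varphi$ has a local maximum (resp. minimum), $\varphi_t+H(x_0,t_0,D\varphi)\le 0$ (resp. $\ge 0$) at $(x_0,t_0)$; a viscosity solution is both. *)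

(* Defs.v *)
From HB Require Import structures.
From mathcomp Require Import all_boot all_order all_algebra.
From mathcomp Require Import all_classical all_reals all_analysis.
Import Order.TTheory GRing.Theory Num.Theory.
Import numFieldNormedType.Exports.


Local Open Scope classical_set_scope.
Local Open Scope ring_scope.

(* The norm [`|x|] on ['rV[R]_d] is the maximum norm, which induces the same
   topology and derivatives as the Euclidean norm; every length in the
   statement is the Euclidean one below. *)
Definition enorm {R : realType} {d : nat} (x : 'rV[R]_d) : R :=
  Num.sqrt (\sum_(i < d) x 0 i ^+ 2).

Definition eball {R : realType} (d : nat) (r : R) : set 'rV[R]_d :=
  [set x | enorm x < r].

Definition cylinder {R : realType} (d : nat) (r a b : R) :
    set ('rV[R]_d * R) :=
  eball d r `*` `[a, b].

(* C^oo on the whole space: every iterated directional derivative, of any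
   order (including 0) and in any directions, is differentiable. *)
Definition smooth {R : realType} {V : normedModType R} (phi : V -> R) : Prop :=
  forall (vs : seq V) (z : V),
    differentiable (foldr (fun v f => 'D_v f) phi vs) z.

Definition Dx {R : realType} {d : nat} (phi : 'rV[R]_d * R -> R)
    (z : 'rV[R]_d * R) : 'rV[R]_d :=
  \row_(i < d) 'D_(delta_mx 0 i, 0) phi z.

Definition Dt {R : realType} {d : nat} (phi : 'rV[R]_d * R -> R)
    (z : 'rV[R]_d * R) : R :=
  'D_(0, 1) phi z.

(* Local extrema are taken relative to [Q]. *)
Definition local_max_at {T : topologicalType} {R : realType} (Q : set T)
    (f : T -> R) (z0 : T) : Prop :=
  \forall z \near z0, Q z -> f z <= f z0.

Definition local_min_at {T : topologicalType} {R : realType} (Q : set T)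
    (f : T -> R) (z0 : T) : Prop :=
  \forall z \near z0, Q z -> f z0 <= f z.

(* Viscosity notions for u_t + H(x, t, Du) = 0 in [Q]; [H] is not assumed
   continuous and no semicontinuous envelopes are taken. *)
Definition viscosity_subsolution {R : realType} {d : nat}
    (H : 'rV[R]_d -> R -> 'rV[R]_d -> R) (Q : set ('rV[R]_d * R))
    (u : 'rV[R]_d * R -> R) : Prop :=
  {within Q, continuous u} /\
  forall (phi : 'rV[R]_d * R -> R) (z0 : 'rV[R]_d * R),
    smooth phi -> Q° z0 -> local_max_at Q (fun z => u z - phi z) z0 ->
    Dt phi z0 + H z0.1 z0.2 (Dx phi z0) <= 0.

Definition viscosity_supersolution {R : realType} {d : nat}
    (H : 'rV[R]_d -> R -> 'rV[R]_d -> R) (Q : set ('rV[R]_d * R))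
    (u : 'rV[R]_d * R -> R) : Prop :=
  {within Q, continuous u} /\
  forall (phi : 'rV[R]_d * R -> R) (z0 : 'rV[R]_d * R),
    smooth phi -> Q° z0 -> local_min_at Q (fun z => u z - phi z) z0 ->
    0 <= Dt phi z0 + H z0.1 z0.2 (Dx phi z0).

Definition viscosity_solution {R : realType} {d : nat}
    (H : 'rV[R]_d -> R -> 'rV[R]_d -> R) (Q : set ('rV[R]_d * R))
    (u : 'rV[R]_d * R -> R) : Prop :=
  viscosity_subsolution H Q u /\ viscosity_supersolution H Q u.

(* For a function that is continuous on a cylinder of positive height, this
   supremum is its L^oo norm there. *)
Definition sup_norm {R : realType} {T : Type} (Q : set T) (u : T -> R) :
    \bar R :=
  ereal_sup [set `|u z|%:E | z in Q].

Definition edist {R : realType} {d : nat} (z w : 'rV[R]_d * R) : R :=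
  Num.sqrt (enorm (z.1 - w.1) ^+ 2 + (z.2 - w.2) ^+ 2).

Definition holder_seminorm {R : realType} {d : nat} (alpha : R)
    (Q : set ('rV[R]_d * R)) (u : 'rV[R]_d * R -> R) : \bar R :=
  ereal_sup [set (`|u zw.1 - u zw.2| / edist zw.1 zw.2 `^ alpha)%:E |
             zw in [set zw | [/\ Q zw.1, Q zw.2 & zw.1 != zw.2]]].

Definition holder_norm {R : realType} {d : nat} (alpha : R)
    (Q : set ('rV[R]_d * R)) (u : 'rV[R]_d * R -> R) : \bar R :=
  (sup_norm Q u + holder_seminorm alpha Q u)%E.

(* Main.v *)
Require Import Defs.
From HB Require Import structures.
From mathcomp Require Import all_boot all_order all_algebra.
From mathcomp Require Import all_classical all_reals all_analysis.
From mathcomp Require Import ring lra.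
Import Order.TTheory GRing.Theory Num.Theory.
Import numFieldNormedType.Exports.

Local Open Scope classical_set_scope.
Local Open Scope ring_scope.

(* With q the exponent dual to p, the bounds on H say that u is a subsolution
   of u_t + |Du|^p / A = A and a supersolution of u_t + A |Du|^p = -A.
   The first makes low values of u spread forward in time: u(x, t) exceeds
   u(y, s) by at most about |x - y|^q / (t - s)^(q - 1).  The second makes high
   values on a ball persist: u stays above a slowly sinking paraboloid.
   On a cylinder of radius r and height r^p / w^(p - 1) on which u oscillates
   by at most w, compare u at the initial time with the middle value.  If u is
   below it somewhere near the centre, the first effect lowers the upper bound;
   otherwise the second one raises the lower bound.  Either way the oscillation
   drops by a fixed factor on a smaller cylinder; after rescaling, the zero
   order terms of H only get smaller, so the step iterates and gives geometric
   decay of the oscillation, that is, a Hoelder estimate. *)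

(** * Test functions *)

(* A class of test functions that is large enough for the argument; closed under
   directional derivatives, it consists of smooth functions. *)
Inductive elementary {R : realType} {V : normedModType R} : (V -> R) -> Prop :=
| elem_cst c : elementary (cst c)
| elem_lin (f : {linear V -> R}) : continuous f -> elementary f
| elem_add f g : elementary f -> elementary g -> elementary (f + g)
| elem_mul f g : elementary f -> elementary g -> elementary (f * g)
| elem_exp f : elementary f -> elementary (expR \o f).

Lemma elementary_opp {R : realType} {V : normedModType R} (f : V -> R) :
  elementary f -> elementary (- f).
Proof.
move=> ef; rewrite (_ : - f = cst (-1) * f).
  by apply: elem_mul => //; exact: elem_cst.
by apply/funext => z; rewrite !fctE mulN1r.
Qed.

Lemma elementary_differentiable {R : realType} {V : normedModType R}
  (f : V -> R) : elementary f -> forall z, differentiable f z.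
Proof.
elim=> {f} [c|f cf|f g _ df _ dg|f g _ df _ dg|f _ df] z.
- exact: differentiable_cst.
- exact: linear_differentiable.
- exact: differentiableD.
- exact: differentiableM.
- apply: differentiable_comp => //.
  exact/derivable1_diffP/derivable_expR.
Qed.

Lemma derive_expR_comp {R : realType} {V : normedModType R} (f : V -> R)
  (v z : V) : differentiable f z ->
  'D_v (expR \o f) z = expR (f z) * 'D_v f z.
Proof.
move=> df; have de : differentiable (expR : R -> R) (f z).
  exact/derivable1_diffP/derivable_expR.
rewrite deriveE; last exact: differentiable_comp.
rewrite diff_comp //= -(deriveE _ df).
have H x : 'd (expR : R -> R) (f z) x = x * 'd (expR : R -> R) (f z) 1.
  by rewrite -[in LHS](mulr1 x); exact: linearZ.
by rewrite H -(deriveE _ de) derive_val mulrC.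
Qed.

Lemma elementary_derive {R : realType} {V : normedModType R}
  (f : V -> R) (v : V) : elementary f -> elementary ('D_v f).
Proof.
elim=> {f} [c|f cf|f g ef df eg dg|f g ef df eg dg|f ef df].
- rewrite (_ : 'D_v _ = cst 0); first exact: elem_cst.
  by apply/funext => z; rewrite derive_cst.
- rewrite (_ : 'D_v _ = cst (f v)); first exact: elem_cst.
  apply/funext => z; rewrite deriveE; last exact: linear_differentiable.
  by rewrite diff_lin.
- rewrite (_ : 'D_v _ = 'D_v f + 'D_v g); first exact: elem_add.
  apply/funext => z; rewrite deriveD //; exact/diff_derivable/elementary_differentiable.
- rewrite (_ : 'D_v _ = f * 'D_v g + g * 'D_v f).
    by apply: elem_add; apply: elem_mul.
  apply/funext => z; rewrite deriveM //; exact/diff_derivable/elementary_differentiable.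
- rewrite (_ : 'D_v _ = (expR \o f) * 'D_v f).
    by apply: elem_mul => //; exact: elem_exp.
  apply/funext => z; rewrite derive_expR_comp //.
  exact: elementary_differentiable.
Qed.

Lemma elementary_smooth {R : realType} {V : normedModType R} (f : V -> R) :
  elementary f -> smooth f.
Proof.
move=> ef vs; apply: elementary_differentiable.
by elim: vs => //= v vs; exact: elementary_derive.
Qed.

(** * Coordinates, time penalty and paraboloid barriers *)

Section coord.
Context {R : realType} {d : nat} (i : 'I_d).

(** A named map, so that a linear structure can be attached to it and [elem_lin] applies. *)
Definition xcoord (z : 'rV[R]_d * R) : R := z.1 0 i.

Lemma xcoord_is_linear : linear xcoord.
Proof. by move=> a u v; rewrite /xcoord /= !mxE. Qed.

HB.instance Definition _ :=
  GRing.isLinear.Build R ('rV[R]_d * R)%type R _ xcoord xcoord_is_linear.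

Lemma xcoord_continuous : continuous xcoord.
Proof.
move=> z; apply: (@continuous_comp _ _ _ fst (fun x : 'rV[R]_d => x 0 i)).
  exact: cvg_fst.
exact: coord_continuous.
Qed.

End coord.

Definition tcoord {R : realType} {d : nat} (z : 'rV[R]_d * R) : R := z.2.

Lemma tcoord_is_linear {R : realType} {d : nat} : linear (@tcoord R d).
Proof. by []. Qed.

HB.instance Definition _ {R : realType} {d : nat} :=
  GRing.isLinear.Build R ('rV[R]_d * R)%type R _ (@tcoord R d) tcoord_is_linear.

Lemma tcoord_continuous {R : realType} {d : nat} : continuous (@tcoord R d).
Proof. by move=> z; exact: cvg_snd. Qed.

Lemma is_derive_tcoord {R : realType} {d : nat} (w z : 'rV[R]_d * R) :
  is_derive z w (tcoord : 'rV[R]_d * R -> R) w.2.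
Proof.
have dt : differentiable (tcoord : 'rV[R]_d * R -> R) z.
  exact/linear_differentiable/tcoord_continuous.
apply: DeriveDef; first exact: diff_derivable.
by rewrite deriveE // diff_lin //; exact: tcoord_continuous.
Qed.

(* Added to a barrier, it keeps a maximum point of the difference away from the
   final time and only increases the time derivative. *)
Definition tpenalty {R : realType} {d : nat} (eta N t0 : R) :
    'rV[R]_d * R -> R :=
  cst eta * (expR \o (cst N * tcoord + cst (- (N * t0)))).

Section tpenalty.
Context {R : realType} {d : nat} (eta N t0 : R).

Let elem_exponent :
  elementary (cst N * tcoord + cst (- (N * t0)) : 'rV[R]_d * R -> R).
Proof.
apply: elem_add; last exact: elem_cst.
apply: elem_mul; first exact: elem_cst.
exact/elem_lin/tcoord_continuous.
Qed.

Lemma tpenaltyE (z : 'rV[R]_d * R) :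
  tpenalty eta N t0 z = eta * expR (N * (z.2 - t0)).
Proof. by rewrite /tpenalty !fctE /tcoord mulrBr. Qed.

Lemma tpenalty_elementary :
  elementary (tpenalty eta N t0 : 'rV[R]_d * R -> R).
Proof. by apply: elem_mul; [exact: elem_cst|exact: elem_exp]. Qed.

Lemma derive_tpenalty (w z : 'rV[R]_d * R) :
  'D_w (tpenalty eta N t0) z = N * w.2 * tpenalty eta N t0 z.
Proof.
have df := elementary_differentiable _ elem_exponent z.
have T := is_derive_tcoord w z.
rewrite /tpenalty deriveM; [|exact: derivable_cst|]; last first.
  exact/diff_derivable/(elementary_differentiable _ (elem_exp _ elem_exponent)).
rewrite derive_cst (derive_expR_comp _ _ _ df) derive_val !fctE /GRing.scale /=.
ring.
Qed.

End tpenalty.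

(** A paraboloid of opening [g] whose vertex starts at [x1] at time [s] and travels with velocity
    [v], its height changing at rate [L]. One propagation estimate takes [v] along a segment, the
    other [v = 0]. *)
Definition barrier {R : realType} {d : nat} (a L s g : R) (x1 v : 'rV[R]_d)
    (z : 'rV[R]_d * R) : R :=
  a + L * (z.2 - s) + g * enorm (z.1 - x1 - (z.2 - s) *: v) ^+ 2.

Lemma enormE {R : realType} {d : nat} (x : 'rV[R]_d) :
  enorm x ^+ 2 = \sum_(i < d) x 0 i ^+ 2.
Proof. by rewrite sqr_sqrtr // sumr_ge0 // => i _; rewrite sqr_ge0. Qed.

Section barrier.
Context {R : realType} {d : nat} (a L s g : R) (x1 v : 'rV[R]_d).
(** Component [i] of the offset from the moving vertex, expanded as an affine function so that the
    barrier is a polynomial in the coordinates. *)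
Let lin i : 'rV[R]_d * R -> R :=
  (xcoord i + cst (- v 0 i) * tcoord) + cst (s * v 0 i - x1 0 i).

Let barrierE : barrier a L s g x1 v =
  cst (a - L * s) + cst L * tcoord + cst g * \sum_(i < d) (lin i * lin i).
Proof.
apply/funext => z; rewrite /barrier enormE !fctE fct_sumE; congr (_ + _ * _).
  by rewrite /tcoord; ring.
apply: eq_bigr => i _; rewrite /lin !mxE !fctE /xcoord /tcoord; ring.
Qed.

Let elem_sum (F : 'I_d -> 'rV[R]_d * R -> R) :
  (forall i, elementary (F i)) -> elementary (\sum_(i < d) F i).
Proof.
by move=> eF; elim/big_rec: _ => [|i x _ ex]; [exact: elem_cst|exact: elem_add].
Qed.

Let elem_linc i : elementary (lin i).
Proof.
apply: elem_add; last exact: elem_cst.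
apply: elem_add; first exact/elem_lin/xcoord_continuous.
apply: elem_mul; first exact: elem_cst.
exact/elem_lin/tcoord_continuous.
Qed.

Lemma barrier_elementary : elementary (barrier a L s g x1 v).
Proof.
rewrite barrierE; apply: elem_add.
  apply: elem_add; first exact: elem_cst.
  by apply: elem_mul; [exact: elem_cst|exact/elem_lin/tcoord_continuous].
apply: elem_mul; first exact: elem_cst.
by apply: elem_sum => i; apply: elem_mul; exact: elem_linc.
Qed.

Let derive_lin i w z : 'D_w (lin i) z = w.1 0 i - w.2 * v 0 i.
Proof.
have dx : differentiable (xcoord i : 'rV[R]_d * R -> R) z.
  exact/linear_differentiable/xcoord_continuous.
have X : is_derive z w (xcoord i : 'rV[R]_d * R -> R) (w.1 0 i).
  apply: DeriveDef; first exact: diff_derivable.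
  by rewrite deriveE // diff_lin //; exact: xcoord_continuous.
have T := is_derive_tcoord w z.
rewrite /lin derive_val /GRing.scale /=; ring.
Qed.

Lemma derive_barrier w z : 'D_w (barrier a L s g x1 v) z =
  L * w.2 + g *+ 2 * \sum_(i < d) (z.1 - x1 - (z.2 - s) *: v) 0 i *
                               (w.1 0 i - w.2 * v 0 i).
Proof.
have dl i := elementary_differentiable _ (elem_linc i) z.
have T := is_derive_tcoord w z.
rewrite barrierE.
have S : is_derive z w (\sum_(i < d) lin i * lin i)
  (\sum_(i < d) (lin i z *: 'D_w (lin i) z + lin i z *: 'D_w (lin i) z)).
  apply: is_derive_sum => i.
  by apply: is_deriveM; apply: derivableP; exact: diff_derivable.
rewrite derive_val /GRing.scale /= !mulr0 !addr0 add0r.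
congr (_ + _); rewrite !mulr_sumr.
apply: eq_bigr => i _.
rewrite derive_lin /lin !fctE /xcoord /tcoord !mxE.
ring.
Qed.

End barrier.

Section barrier_gradient.
Context {R : realType} {d : nat} (a L s g : R) (x1 v : 'rV[R]_d).
Local Notation offset z := (z.1 - x1 - (z.2 - s) *: v).

Lemma Dt_barrier z : Dt (barrier a L s g x1 v) z =
  L - g *+ 2 * \sum_(i < d) offset z 0 i * v 0 i.
Proof.
rewrite /Dt derive_barrier /= mulr1; congr (_ + _).
rewrite -mulrN -sumrN; congr (_ * _); apply: eq_bigr => i _.
by rewrite !mxE; ring.
Qed.

Lemma Dx_barrier z : Dx (barrier a L s g x1 v) z = (g *+ 2) *: offset z.
Proof.
apply/rowP => i; rewrite !mxE derive_barrier /= mulr0 add0r; congr (_ * _).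
rewrite (bigD1 i) //= big1 => [|j ji]; first by rewrite !mxE !eqxx /=; ring.
by rewrite !mxE eqxx (negbTE ji) /=; ring.
Qed.

End barrier_gradient.

(** * Euclidean norm *)

Section enorm.
Context {R : realType} {d : nat}.
Implicit Types x y : 'rV[R]_d.

Lemma enorm_ge0 x : 0 <= enorm x. Proof. exact: sqrtr_ge0. Qed.

Lemma enorm0 : enorm (0 : 'rV[R]_d) = 0.
Proof.
by rewrite /enorm big1 ?sqrtr0 // => i _; rewrite mxE expr0n.
Qed.

Lemma enormZ (c : R) x : enorm (c *: x) = `|c| * enorm x.
Proof.
rewrite /enorm -sqrtr_sqr -sqrtrM ?sqr_ge0 // mulr_sumr; congr Num.sqrt.
by apply: eq_bigr => i _; rewrite !mxE exprMn.
Qed.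

Lemma enormN x : enorm (- x) = enorm x.
Proof. by rewrite -scaleN1r enormZ normrN1 mul1r. Qed.

Lemma enormC x y : enorm (x - y) = enorm (y - x).
Proof. by rewrite -enormN opprB. Qed.

Lemma enorm_eq0 x : enorm x = 0 -> x = 0.
Proof.
move=> x0; apply/rowP => i; rewrite mxE; apply/eqP; rewrite -sqrf_eq0.
have : \sum_(i < d) x 0 i ^+ 2 = 0 by rewrite -enormE x0 expr0n.
by move/psumr_eq0P => -> // j _; rewrite sqr_ge0.
Qed.

Lemma cauchy_schwarz x y : \sum_(i < d) x 0 i * y 0 i <= enorm x * enorm y.
Proof.
have [/enorm_eq0 ->|x0] := eqVneq (enorm x) 0.
  by rewrite enorm0 mul0r big1 // => i _; rewrite mxE mul0r.
have [/enorm_eq0 ->|y0] := eqVneq (enorm y) 0.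
  by rewrite enorm0 mulr0 big1 // => i _; rewrite mxE mulr0.
have xp : 0 < enorm x by rewrite lt_neqAle eq_sym x0 enorm_ge0.
have yp : 0 < enorm y by rewrite lt_neqAle eq_sym y0 enorm_ge0.
set a := enorm x in xp *; set b := enorm y in yp *.
(* Young's inequality in each coordinate, weighted so that each of the two sums contributes
   [a * b / 2]. *)
apply: (@le_trans _ _ (\sum_(i < d)
    ((b / a / 2) * x 0 i ^+ 2 + (a / b / 2) * y 0 i ^+ 2))).
  apply: ler_sum => i _; rewrite -subr_ge0.
  rewrite (_ : _ - _ = (2 * a * b)^-1 * (b * x 0 i - a * y 0 i) ^+ 2).
    by rewrite mulr_ge0 ?sqr_ge0 // invr_ge0 !mulr_ge0 // ltW.
  by field; rewrite x0 y0.
rewrite big_split /= -!mulr_sumr -!enormE -/a -/b.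
rewrite le_eqVlt; apply/orP; left; apply/eqP.
by field; rewrite x0 y0.
Qed.

Lemma enormD x y : enorm (x + y) <= enorm x + enorm y.
Proof.
rewrite -(@ler_pXn2r _ 2) ?nnegrE ?addr_ge0 ?enorm_ge0 //.
rewrite sqrrD !enormE.
under eq_bigr do rewrite mxE sqrrD.
by rewrite !big_split /= lerD2r lerD2l mulr2n lerD ?cauchy_schwarz.
Qed.

Lemma enorm_trans y x z : enorm (x - z) <= enorm (x - y) + enorm (y - z).
Proof. by apply: le_trans (enormD _ _); rewrite addrA subrK. Qed.

Lemma enorm_continuous : continuous (enorm : 'rV[R]_d -> R).
Proof.
move=> x; apply: (@continuous_comp _ _ _
  (fun x : 'rV[R]_d => \sum_(i < d) x 0 i ^+ 2) Num.sqrt).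
  apply: (@continuous_big _ _ _ _ _ add_continuous _ _
    (fun i (x : 'rV[R]_d) => x 0 i ^+ 2)) => i _ y.
  apply: (@continuous_comp _ _ _ (fun x : 'rV[R]_d => x 0 i) (fun a => a ^+ 2)).
    exact: coord_continuous.
  exact: exprn_continuous.
exact: sqrt_continuous.
Qed.

Lemma dist_continuous x0 : continuous (fun x : 'rV[R]_d => enorm (x - x0)).
Proof.
move=> x; apply: (@continuous_comp _ _ _ (fun x : 'rV[R]_d => x - x0) enorm).
  by apply: (@continuousB _ _ 'rV[R]_d idfun (cst x0)); [exact: cvg_id|exact: cst_continuous].
exact: enorm_continuous.
Qed.

Lemma coord_le_enorm x i : `|x 0 i| <= enorm x.
Proof.
rewrite -sqrtr_sqr ler_wsqrtr // (bigD1 i) //= lerDl sumr_ge0 // => j _.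
exact: sqr_ge0.
Qed.

Lemma norm_le_enorm x : `|x| <= enorm x.
Proof.
rewrite [leLHS]mx_normrE; apply: bigmax_le => [|[i j] _ /=].
  exact: enorm_ge0.
by rewrite (ord1 i) coord_le_enorm.
Qed.

(** Boundedness refers to the maximum norm, which the Euclidean norm dominates. *)
Lemma closed_eball_compact x0 (r : R) : compact [set x | enorm (x - x0) <= r].
Proof.
apply: bounded_closed_compact; last first.
  rewrite (_ : [set _ | _] = (fun x => enorm (x - x0)) @^-1` [set y | y <= r]) //.
  apply: preimage_closed; last exact: closed_le.
  by move=> x _; exact: dist_continuous.
exists (r + enorm x0); split; first exact: num_real.
move=> M /ltW rM x /= xr; apply: le_trans rM.
have xb : enorm x <= r + enorm x0.
  have := enorm_trans x0 x 0; rewrite !subr0; lra.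
exact: le_trans (norm_le_enorm _) xb.
Qed.

End enorm.

(** * Comparison principle *)

Section comparison.
Context {R : realType} {d : nat}.
Implicit Types (G : 'rV[R]_d -> R) (u phi : 'rV[R]_d * R -> R)
  (x : 'rV[R]_d) (s t r rho eta : R).

Local Notation Q := (@cylinder R d 1 0 1).

(* Used with [G] the lower bound of the Hamiltonian for [u], and with [G] the
   opposite of its upper bound for [- u]. *)
Definition gradient_subsolution G u : Prop :=
  {within Q, continuous u} /\
  forall phi z0, elementary phi -> Q° z0 ->
    local_max_at Q (fun z => u z - phi z) z0 ->
    Dt phi z0 + G (Dx phi z0) <= 0.

Lemma space_dist_continuous (x0 : 'rV[R]_d) :
  continuous (fun z : 'rV[R]_d * R => enorm (z.1 - x0)).
Proof.
move=> z; apply: (@continuous_comp ('rV[R]_d * R)%type 'rV[R]_d _ fst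
  (fun x => enorm (x - x0))).
  exact: cvg_fst.
exact: dist_continuous.
Qed.

Lemma cylinder_interior (x : 'rV[R]_d) t :
  enorm x < 1 -> 0 < t -> t < 1 -> Q° (x, t).
Proof.
move=> x1 t0 t1; rewrite /interior /cylinder /eball /=.
have xc := @space_dist_continuous 0 (x, t).
have tc := @tcoord_continuous R d (x, t).
near=> z; split => /=.
  rewrite -[z.1]subr0; near: z.
  by apply: (cvgr_lt _ xc); rewrite subr0.
rewrite in_itv /=; apply/andP; split; apply/ltW; near: z.
  exact: (cvgr_gt _ tc).
exact: (cvgr_lt _ tc).
Unshelve. all: by end_near. Qed.

Definition space_time_ball (x0 : 'rV[R]_d) (rho s t : R) :=
  [set x | enorm (x - x0) <= rho] `*` `[s, t]%classic.

Lemma space_time_ball_compact x0 rho s t : compact (space_time_ball x0 rho s t).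
Proof.
exact: (compact_setX (closed_eball_compact _ _) (@segment_compact _ _ _)).
Qed.

Lemma space_time_ball_sub x0 rho s t : enorm x0 + rho < 1 -> 0 <= s -> t <= 1 ->
  space_time_ball x0 rho s t `<=` Q.
Proof.
move=> x0r s0 t1 [x r] [/= xr]; rewrite !in_itv /= => /andP[sr rt].
split; rewrite /= ?in_itv /= ?(le_trans s0) ?(le_trans rt) //.
rewrite /eball /=.
by have := enorm_trans x0 x 0; rewrite !subr0; lra.
Qed.

(** If [u - phi] were positive somewhere, subtracting a penalty that grows exponentially in time
    would give a maximum point off the bottom, the lateral boundary and the final time. There [phi]
    plus the penalty is an admissible test function, against strictness. *)
Lemma comparison_before G u phi x0 rho s t1 (x : 'rV[R]_d) t :
  gradient_subsolution G u -> elementary phi ->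
  enorm x0 + rho < 1 -> 0 <= s -> t1 <= 1 ->
  (forall z, enorm (z.1 - x0) < rho -> s < z.2 < t1 ->
     0 < Dt phi z + G (Dx phi z)) ->
  (forall y, enorm (y - x0) <= rho -> u (y, s) <= phi (y, s)) ->
  (forall y r, enorm (y - x0) = rho -> s <= r <= t1 ->
     u (y, r) <= phi (y, r)) ->
  enorm (x - x0) <= rho -> s <= t < t1 -> u (x, t) <= phi (x, t).
Proof.
move=> [cu usub] ephi x0r s0 t1le1 strict bottom lateral xr /andP[st tt1].
rewrite leNgt; apply/negP => gt0.
set K := space_time_ball x0 rho s t1.
have KQ : K `<=` Q by exact: space_time_ball_sub.
have ccu : {within K, continuous u} by exact: continuous_subspaceW cu.
have Kxt : K (x, t) by split => //=; rewrite in_itv /= st ltW.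
have cwith psi : elementary psi -> {within K, continuous (u - psi)}.
  move=> epsi z; apply: (@continuousB R R^o (subspace K) u psi z (ccu z)).
  move: z; apply: continuous_subspaceT => z.
  exact/differentiable_continuous/elementary_differentiable.
have [zb _ ub] := compact_EVT_max (ex_intro _ _ Kxt)
  (space_time_ball_compact _ _ _ _) (cwith _ ephi).
pose B := (u - phi) zb.
(* Half the gap at [(x, t)], where the penalty equals [eta]: the penalised difference stays positive
   there. *)
pose eta := (u (x, t) - phi (x, t)) / 2.
have eta0 : 0 < eta by rewrite /eta; lra.
have B0 : 0 < B.
  by apply: lt_le_trans (ub (x, t) _); rewrite ?inE // !fctE /=; lra.
(* As [expR y >= 1 + y], the penalty at time [t1] is at least [B + 2 * eta], above the maximum [B]
   of [u - phi]. *)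
pose N := (B / eta + 1) / (t1 - t).
have N0 : 0 < N.
  by rewrite /N divr_gt0 ?subr_gt0 // addr_gt0 // divr_gt0.
pose psi := phi + tpenalty eta N t.
have epsi : elementary psi by apply: elem_add => //; exact: tpenalty_elementary.
have [[y r] Kyr ymax] := compact_EVT_max (ex_intro _ _ Kxt)
  (space_time_ball_compact _ _ _ _) (cwith _ epsi).
have pen0 z : 0 < tpenalty eta N t (z : 'rV[R]_d * R).
  by rewrite tpenaltyE mulr_gt0 // expR_gt0.
have pos : 0 < (u - psi) (y, r).
  apply: lt_le_trans (ymax (x, t) _); rewrite ?inE //.
  rewrite /psi !fctE tpenaltyE /= subrr mulr0 expR0 /eta; lra.
have {}pos : tpenalty eta N t (y, r) < u (y, r) - phi (y, r).
  by move: pos; rewrite /psi !fctE; lra.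
have Kyr' := Kyr; move: Kyr; rewrite inE => -[/= yr]; rewrite in_itv /= => /andP[sr rt1].
have rlt : r < t1.
  rewrite lt_neqAle rt1 andbT; apply/eqP => r1.
  have := ub (y, r) Kyr'; rewrite -/B !fctE => yB.
  move: (lt_le_trans pos yB); apply/negP; rewrite -leNgt tpenaltyE r1 /=.
  have := expR_ge1Dx (N * (t1 - t)).
  rewrite /N divfK; last by rewrite subr_eq0 gt_eqF.
  move=> /(ler_wpM2l (ltW eta0)); apply: le_trans.
  rewrite !mulrDr mulrCA divff ?gt_eqF //; lra.
have sltr : s < r.
  rewrite lt_neqAle sr andbT; apply/eqP => rs.
  by have := bottom y yr; have := pen0 (y, r); rewrite -rs in pos *; lra.
have ylt : enorm (y - x0) < rho.
  rewrite lt_neqAle yr andbT; apply/eqP => ey.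
  have := lateral y r ey; rewrite sr rt1 => /(_ isT).
  by have := pen0 (y, r); lra.
have := usub psi (y, r) epsi; apply/not_implyP; split.
  apply: cylinder_interior; rewrite ?(le_lt_trans s0) ?(lt_le_trans rlt) //.
  by have := enorm_trans x0 y 0; rewrite !subr0; lra.
apply/not_implyP; split.
  have yc := @space_dist_continuous x0 (y, r).
  have rc := @tcoord_continuous R d (y, r).
  rewrite /local_max_at; near=> z => Qz.
  apply: ymax; rewrite inE; split => /=.
    by apply/ltW; near: z; exact: (cvgr_lt _ yc).
  rewrite in_itv /=; apply/andP; split; apply/ltW; near: z.
    exact: (cvgr_gt _ rc).
  exact: (cvgr_lt _ rc).
have dphi w : derivable phi (y, r) w.
  exact/diff_derivable/elementary_differentiable.
have dpen w : derivable (tpenalty eta N t) (y, r) w.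
  exact/diff_derivable/elementary_differentiable/tpenalty_elementary.
(* The penalty does not change the spatial gradient and adds a positive amount to the time
   derivative, so strictness carries over from [phi]. *)
have -> : Dx psi (y, r) = Dx phi (y, r).
  by apply/rowP => i; rewrite !mxE deriveD // derive_tpenalty /= mulr0 mul0r addr0.
rewrite /Dt deriveD // derive_tpenalty mulr1 -/(Dt _ _).
apply/negP; rewrite -ltNge.
have := strict (y, r) ylt; rewrite sltr rlt => /(_ isT).
by have := mulr_gt0 N0 (pen0 (y, r)); lra.
Unshelve. all: by end_near. Qed.

Lemma within_earlier u (x : 'rV[R]_d) s t :
  {within Q, continuous u} -> enorm x < 1 -> 0 <= s -> s < t -> t <= 1 ->
  0 < u (x, t) -> exists2 r, s <= r < t & 0 < u (x, r).
Proof.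
move=> cu x1 s0 st t1 ut.
have Qx r : s <= r <= t -> Q (x, r).
  move=> /andP[sr rt]; split => //=; rewrite in_itv /=.
  by rewrite (le_trans s0) // (le_trans rt).
have /subspace_continuousP/(_ _ (Qx t _)) := cu.
rewrite lexx ltW // => /(_ isT) cut.
have : \forall z \near (x, t), Q z -> 0 < u z by exact: (cvgr_gt _ cut).
move=> /nbhs_ballP[e /= e0 he].
have m_lt : Num.max s (t - e / 2) < t by rewrite gt_max st /=; lra.
have m_ge : s <= Num.max s (t - e / 2) by rewrite le_max lexx.
exists (Num.max s (t - e / 2)); first by rewrite m_ge.
apply: he; last by apply: Qx; rewrite m_ge ltW.
split => /=; first exact: ballxx.
rewrite -ball_normE /= ger0_norm ?subr_ge0 1?ltW // ltrBlDl -ltrBlDr.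
by rewrite lt_max; apply/orP; right; lra.
Qed.

(** Controls the initial values close to the vertex of a barrier, where its quadratic term gives
    nothing. *)
Lemma near_space_upper u (x : 'rV[R]_d) s eta :
  {within Q, continuous u} -> enorm x < 1 -> 0 <= s <= 1 -> 0 < eta ->
  exists2 delta, 0 < delta & forall y, enorm y < 1 -> enorm (y - x) < delta ->
    u (y, s) < u (x, s) + eta.
Proof.
move=> cu x1 s01 eta0.
have Qx y : enorm y < 1 -> Q (y, s) by move=> y1; split.
have /subspace_continuousP/(_ _ (Qx _ x1)) cut := cu.
have : \forall z \near (x, s), Q z -> u z < u (x, s) + eta.
  by apply: (cvgr_lt _ cut); rewrite ltrDl.
move=> /nbhs_ballP[e /= e0 he]; exists e => // y y1 yx.
apply: he; last exact: Qx.
split => /=; last exact: ballxx.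
rewrite -ball_normE /= -normrN opprB.
exact: le_lt_trans (norm_le_enorm _) yx.
Qed.

(** The closing time is now included, even [t1 = 1], where no point is interior to the cylinder: by
    continuity, a violation at [t1] would already occur slightly earlier. *)
Lemma comparison G u phi x0 rho s t1 (x : 'rV[R]_d) t :
  gradient_subsolution G u -> elementary phi ->
  enorm x0 + rho < 1 -> 0 <= s -> t1 <= 1 ->
  (forall z, enorm (z.1 - x0) < rho -> s < z.2 < t1 ->
     0 < Dt phi z + G (Dx phi z)) ->
  (forall y, enorm (y - x0) <= rho -> u (y, s) <= phi (y, s)) ->
  (forall y r, enorm (y - x0) = rho -> s <= r <= t1 ->
     u (y, r) <= phi (y, r)) ->
  enorm (x - x0) <= rho -> s <= t <= t1 -> u (x, t) <= phi (x, t).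
Proof.
move=> usub ephi x0r s0 t1le1 strict bottom lateral xr /andP[st].
have before r : s <= r < t1 -> u (x, r) <= phi (x, r).
  exact: (comparison_before _ _ _ _ _ _ _ _ _ usub ephi x0r s0 t1le1).
rewrite le_eqVlt => /orP[/eqP tE|tt1]; last by apply: before; rewrite st.
subst t; move: st; rewrite le_eqVlt => /orP[/eqP <-|st]; first exact: bottom.
rewrite leNgt; apply/negP => gt0.
have [cu _] := usub.
have xlt1 : enorm x < 1 by have := enorm_trans x0 x 0; rewrite !subr0; lra.
have cdiff : {within Q, continuous (u - phi)}.
  move=> z; apply: (@continuousB R R^o (subspace Q) u phi z (cu z)).
  move: z; apply: continuous_subspaceT => z.
  exact/differentiable_continuous/elementary_differentiable.
have [|r rst] := within_earlier _ _ _ _ cdiff xlt1 s0 st t1le1.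
  by rewrite !fctE subr_gt0.
by rewrite !fctE subr_gt0 ltNge before.
Qed.

End comparison.

(** * Propagation of low and high values *)

(* Up to a constant factor, the Legendre transform of [m |-> m `^ p / A]. *)
Definition line_cost {R : realType} (p A V : R) : R :=
  V * (A * V) `^ (p - 1)^-1.

Lemma line_cost_ge0 {R : realType} (p A V : R) : 0 <= V -> 0 <= line_cost p A V.
Proof. by move=> V0; rewrite mulr_ge0 ?powR_ge0. Qed.

Lemma young_cutoff {R : realType} (p A V m : R) : 1 < p -> 0 < A -> 0 <= V ->
  0 <= m -> m * V - A^-1 * m `^ p <= line_cost p A V.
Proof.
move=> p1 A0 V0 m0; rewrite /line_cost; have p0 : 0 < p - 1 by lra.
have [mle|mgt] := leP m ((A * V) `^ (p - 1)^-1).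
  have := ler_wpM2l V0 mle; have := powR_ge0 m p.
  have : 0 < A^-1 by rewrite invr_gt0.
  nra.
have mpos : 0 < m by rewrite (le_lt_trans _ mgt) // powR_ge0.
have AVm : A * V <= m `^ (p - 1).
  have -> : A * V = ((A * V) `^ (p - 1)^-1) `^ (p - 1).
    by rewrite -powRrM mulVf ?gt_eqF // powRr1 // mulr_ge0 // ltW.
  by apply: ge0_ler_powR; rewrite ?nnegrE ?powR_ge0 // ltW.
have VA : V <= A^-1 * m `^ (p - 1) by rewrite mulrC ler_pdivlMr // mulrC.
have := ler_wpM2l m0 VA.
have -> : m `^ p = m * m `^ (p - 1) by rewrite mulr_powRB1 //; lra.
have : 0 <= V * (A * V) `^ (p - 1)^-1 by rewrite mulr_ge0 ?powR_ge0.
rewrite [A^-1 * (m * _)]mulrCA; lra.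
Qed.

Section propagation.
Context {R : realType} {d : nat} (p A : R).
Implicit Types (u : 'rV[R]_d * R -> R) (x y : 'rV[R]_d)
  (s t r m h rho c M eta : R).

Local Notation Q := (@cylinder R d 1 0 1).
Definition lower_hamiltonian (xi : 'rV[R]_d) : R := A^-1 * enorm xi `^ p - A.
Definition upper_hamiltonian (xi : 'rV[R]_d) : R := A * enorm xi `^ p + A.

(** Convexity of the ball: the point is the convex combination of [x1] and [x] with weight [k] on
    [x]. *)
Lemma line_in_ball (x0 x1 x : 'rV[R]_d) (c s t r : R) :
  enorm (x1 - x0) <= c -> enorm (x - x0) <= c -> s <= r <= t -> s < t ->
  enorm (x1 + (r - s) *: ((t - s)^-1 *: (x - x1)) - x0) <= c.
Proof.
move=> x1c xc /andP[sr rt] st; pose k := (r - s) / (t - s).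
have ts : 0 < t - s by rewrite subr_gt0.
have k0 : 0 <= k by rewrite divr_ge0 ?subr_ge0 // ltW.
have k1 : 0 <= 1 - k by rewrite subr_ge0 ler_pdivrMr // mul1r lerD2r.
have -> : x1 + (r - s) *: ((t - s)^-1 *: (x - x1)) - x0 =
    (1 - k) *: (x1 - x0) + k *: (x - x0).
  by apply/rowP => i; rewrite !mxE /k; ring.
apply: le_trans (enormD _ _) _; rewrite !enormZ !ger0_norm //.
have := ler_wpM2l k0 xc; have := ler_wpM2l k1 x1c; lra.
Qed.

(* The paraboloid moving along the segment with velocity [v] is a strict
   supersolution whatever its opening [g], so [g] can be taken large enough to
   dominate [u] initially and on the lateral boundary. *)
Lemma growth_along_line u (M : R) x0 rho s t x1 x :
  1 < p -> 0 < A -> gradient_subsolution lower_hamiltonian u ->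
  (forall z, Q z -> `|u z| <= M) ->
  enorm x0 + rho < 1 -> 0 < rho -> 0 <= s -> s < t -> t <= 1 ->
  enorm (x1 - x0) <= rho / 2 -> enorm (x - x0) <= rho / 2 ->
  u (x, t) <= u (x1, s) + (line_cost p A (enorm (x - x1) / (t - s)) + 2 * A) * (t - s).
Proof.
move=> p1 A0 usub uM x0r r0 s0 st t1 x1r xr; set V := _ / (t - s).
set L := _ + 2 * A; apply/ler_addgt0Pr => eta eta0.
have ts : 0 < t - s by rewrite subr_gt0.
have V0 : 0 <= V by rewrite divr_ge0 ?enorm_ge0 // ltW.
have L0 : 0 < L by rewrite /L ltr_wpDl ?line_cost_ge0 // mulr_gt0.
have in1 y : enorm (y - x0) <= rho -> enorm y < 1.
  by have := enorm_trans x0 y 0; rewrite !subr0; lra.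
have [cu _] := usub.
have [||delta d0 near1] := near_space_upper _ x1 s eta cu _ _ eta0.
- by apply: in1; lra.
- by rewrite s0; lra.
(* Squared offsets below [c] at time [s] are covered by continuity of [u] at [(x1, s)]; on the
   lateral boundary the offset is at least [rho / 2]. *)
pose c := Num.min (delta ^+ 2) ((rho / 2) ^+ 2).
have c0 : 0 < c by rewrite lt_min !exprn_gt0 // divr_gt0.
have Qin y r : enorm (y - x0) <= rho -> s <= r <= t -> Q (y, r).
  by move=> /in1 y1 /andP[sr rt]; split => //=; rewrite in_itv /=; lra.
have Qx1 : Q (x1, s) by apply: Qin; [lra|rewrite lexx ltW].
have M0 : 0 <= M by exact: le_trans (uM _ Qx1).
(* For squared offsets of at least [c], the quadratic term then exceeds [2 * M], a bound for the
   oscillation of [u]. *)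
pose g := 2 * M / c.
have g0 : 0 <= g by rewrite divr_ge0 ?mulr_ge0 // ltW.
have gbig y : c <= enorm y ^+ 2 -> 2 * M <= g * enorm y ^+ 2.
  by move=> cy; rewrite /g mulrAC ler_pdivlMr // ler_wpM2l // mulr_ge0.
pose v := (t - s)^-1 *: (x - x1).
have vV : enorm v = V by rewrite enormZ gtr0_norm ?invr_gt0 // mulrC.
have udiff y r : enorm (y - x0) <= rho -> s <= r <= t ->
    u (y, r) <= u (x1, s) + 2 * M.
  move=> yr srt.
  have := uM _ (Qin y r yr srt); rewrite ler_norml => /andP[_ h].
  by have := uM _ Qx1; rewrite ler_norml => /andP[h' _]; lra.
have := comparison _ u (barrier (u (x1, s) + eta) L s g x1 v) x0 rho s t x t
  usub (barrier_elementary _ _ _ _ _ _) x0r s0 t1.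
(* At time [t] the vertex has arrived at [x], so only the risen height remains. *)
have xt : x - x1 - (t - s) *: v = 0.
  by rewrite /v scalerA divff ?gt_eqF // scale1r subrr.
rewrite {5}/barrier /= xt enorm0 expr0n mulr0 addr0 => cmp.
rewrite -addrA [_ * _ + _]addrC addrA; apply: cmp; last 2 first.
- lra.
- by rewrite lexx ltW.
(* By Cauchy-Schwarz the transport term costs at most the gradient norm times [V], which
   [young_cutoff] pays for. Of the [2 * A] in [L], one [A] cancels the zero order term and the other
   gives strictness. *)
- move=> z zr _; rewrite Dt_barrier Dx_barrier /lower_hamiltonian enormZ.
  set y := z.1 - x1 - _.
  have gy : 0 <= `|g *+ 2| * enorm y by rewrite mulr_ge0 ?enorm_ge0.
  have := young_cutoff _ _ _ _ p1 A0 V0 gy.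
  have := cauchy_schwarz y v; rewrite vV.
  rewrite (ger0_norm (mulrn_wge0 _ g0)) => /(ler_wpM2l (mulrn_wge0 2 g0)).
  have slack (S X Y C : R) :
    S <= X -> X - Y <= C -> 0 < C + 2 * A - S + (Y - A) by lra.
  by rewrite mulrA; exact: slack.
- move=> y yr; rewrite /barrier /= subrr mulr0 scale0r subr0 addr0.
  have [yd|dy] := ltP (enorm (y - x1)) delta.
    by have := near1 y (in1 y yr) yd; have := mulr_ge0 g0 (sqr_ge0 (enorm (y - x1))); lra.
  have := gbig (y - x1); rewrite ge_min (ler_pXn2r _ (ltW d0)) ?nnegrE ?enorm_ge0 // dy => /(_ isT).
  have := udiff y s yr; rewrite lexx ltW // => /(_ isT); lra.
- move=> y r yr srt; rewrite /barrier /=; set o := y - x1 - _.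
  have oge : rho / 2 <= enorm o.
    have := line_in_ball _ _ _ _ _ _ r x1r xr srt st; rewrite -/v.
    have := enorm_trans (x1 + (r - s) *: v) y x0.
    by rewrite /o opprD addrA yr; lra.
  have r2 : 0 <= rho / 2 by lra.
  have := gbig o; rewrite ge_min (ler_pXn2r _ r2) ?nnegrE ?enorm_ge0 // oge orbT.
  move=> /(_ isT).
  have := udiff y r; rewrite yr lexx => /(_ isT srt).
  move: srt => /andP[sr rt].
  have : 0 <= L * (r - s) by rewrite mulr_ge0 ?subr_ge0 // ltW.
  lra.
Qed.


(** Comparison of [- u] with a fixed paraboloid of opening [h / rho ^+ 2]: on the sphere it has used
    up the whole gain [h], and its gradient is at most [2 * h / rho], which determines the sinking
    rate. *)
Lemma lower_barrier u x0 rho s t1 m h x t :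
  0 < p -> 0 < A -> gradient_subsolution (fun xi => - upper_hamiltonian xi) (fun z => - u z) ->
  enorm x0 + rho < 1 -> 0 < rho -> 0 <= s -> t1 <= 1 -> 0 <= h ->
  (forall y r, enorm (y - x0) <= rho -> s <= r <= t1 -> m <= u (y, r)) ->
  (forall y, enorm (y - x0) <= rho -> m + h <= u (y, s)) ->
  enorm (x - x0) <= rho -> s <= t <= t1 ->
  m + h - h * (enorm (x - x0) / rho) ^+ 2
    - (A * (2 * h / rho) `^ p + 2 * A) * (t - s) <= u (x, t).
Proof.
move=> p0 A0 usup x0r r0 s0 t1le h0 um ubot xr stt1.
set L := _ + 2 * A.
pose g := h / rho ^+ 2.
have g0 : 0 <= g by rewrite divr_ge0 // sqr_ge0.
have L0 : 0 <= L by rewrite /L addr_ge0 ?mulr_ge0 ?powR_ge0 // ltW.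
have := comparison _ _ (barrier (- (m + h)) L s g x0 0) x0 rho s t1 x t
  usup (barrier_elementary _ _ _ _ _ _) x0r s0 t1le.
rewrite {5}/barrier /= scaler0 subr0 => cmp.
rewrite -lerN2; apply: le_trans (cmp _ _ _ xr stt1) _.
- move=> z zr _; rewrite Dt_barrier Dx_barrier /upper_hamiltonian enormZ.
  rewrite scaler0 subr0 big1 => [|i _]; last by rewrite [X in _ * X]mxE mulr0.
  have : enorm (z.1 - x0) * `|g *+ 2| <= 2 * h / rho.
    rewrite ger0_norm ?mulrn_wge0 //.
    have -> : 2 * h / rho = rho * (g *+ 2) by rewrite /g; field; rewrite gt_eqF.
    by rewrite ler_wpM2r ?mulrn_wge0 // ltW.
  rewrite mulrC => le1.
  have : (`|g *+ 2| * enorm (z.1 - x0)) `^ p <= (2 * h / rho) `^ p.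
    apply: ge0_ler_powR; rewrite ?nnegrE ?mulr_ge0 ?enorm_ge0 ?invr_ge0 //; lra.
  move=> /(ler_wpM2l (ltW A0)); rewrite /L; lra.
- move=> y yr; rewrite /barrier /= subrr mulr0 addr0.
  have := ubot y yr; have := mulr_ge0 g0 (sqr_ge0 (enorm (y - x0 - 0 *: 0))); lra.
- move=> y r yr srt; rewrite /barrier /= scaler0 subr0 yr /g divfK ?sqrf_eq0 ?gt_eqF //.
  have := um y r; rewrite yr lexx => /(_ isT srt).
  move: srt => /andP[sr rt].
  have : 0 <= L * (r - s) by rewrite mulr_ge0 ?subr_ge0.
  lra.
- rewrite /g exprMn exprVn mulrA mulrAC; lra.
Qed.
End propagation.

(** * Improvement of oscillation *)

Lemma ler_line_cost {R : realType} (p A V W : R) : 1 < p -> 0 < A ->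
  0 <= V -> V <= W -> line_cost p A V <= line_cost p A W.
Proof.
move=> p1 A0 V0 VW; rewrite /line_cost ler_pM ?powR_ge0 //.
have W0 := le_trans V0 VW.
have A0' := ltW A0.
apply: ge0_ler_powR; rewrite ?nnegrE ?invr_ge0 ?mulr_ge0 ?ler_wpM2l //.
by lra.
Qed.

Section oscillation.
Context {R : realType} {d : nat} (p A : R).
Implicit Types (u : 'rV[R]_d * R -> R) (x y : 'rV[R]_d)
  (s t r m rho w tau lam kap M : R).

Local Notation Q := (@cylinder R d 1 0 1).
Local Notation subsol u := (gradient_subsolution (lower_hamiltonian p A) u).
Local Notation supersol u := (gradient_subsolution
  (fun xi => - upper_hamiltonian p A xi) (fun z => - u z)).

(** Oscillation at most [w] on a backward cylinder with top centre [(x, t)]; an arbitrary lower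
    bound [m] stands in for the infimum. *)
Definition confined u x t rho tau w : Prop :=
  exists m, forall y r, enorm (y - x) <= rho -> t - tau <= r <= t ->
    m <= u (y, r) <= m + w.

(** Dichotomy at time [t - tau] on the ball of radius [lam * rho]. If [u <= m + w / 2] somewhere,
    growth along segments adds at most [w / 8 + kap * w / 8]. Otherwise [u >= m + kap * w] there,
    and the paraboloid keeps half of that gain. *)
Lemma confined_improve u M x t rho tau w lam kap :
  1 < p -> 0 < A -> subsol u -> supersol u ->
  (forall z, Q z -> `|u z| <= M) ->
  enorm x + rho < 1 -> 0 < rho -> 0 < tau -> tau <= t -> t <= 1 -> 0 < w ->
  0 < lam <= 2^-1 -> 0 < kap <= 2^-1 ->
  2 * A * tau <= kap * w / 8 ->
  line_cost p A (4 * lam * rho / tau) * tau <= w / 8 ->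
  A * (2 * (kap * w) / (lam * rho)) `^ p * tau <= kap * w / 8 ->
  confined u x t rho tau w ->
  confined u x t (lam / 2 * rho) (tau / 2) ((1 - kap / 2) * w).
Proof.
move=> p1 A0 usub usup uM xr rho0 tau0 taut t1 w0 /andP[lam0 lam2]
  /andP[kap0 kap2] c1 c2 c3 [m um].
have s0 : 0 <= t - tau by lra.
have lr0 : 0 < lam * rho by exact: mulr_gt0.
have lr_le : lam * rho <= rho / 2 by have := ler_wpM2r (ltW rho0) lam2; lra.
have kw0 : 0 < kap * w by exact: mulr_gt0.
have kw_le : kap * w <= w / 2 by have := ler_wpM2r (ltW w0) kap2; lra.
have [[x1 [x1r ux1]]|high] := pselect (exists x1,
    enorm (x1 - x) <= lam * rho /\ u (x1, t - tau) <= m + w / 2).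
  exists m => y r yr /andP[tr rt].
  have yr' : enorm (y - x) <= lam * rho by rewrite (le_trans yr) //; lra.
  have /andP[-> _] /= : m <= u (y, r) <= m + w by apply: um; [lra|apply/andP; split; lra].
  have gap : tau / 2 <= r - (t - tau) by lra.
  have gap0 : 0 < r - (t - tau) by lra.
  have := growth_along_line p A u M x (2 * (lam * rho)) (t - tau) r x1 y
    p1 A0 usub uM.
  rewrite mulrAC divff ?pnatr_eq0 // mul1r => /(_ _ _ s0 _ _ x1r yr') H.
  have {}H := H ltac:(lra) ltac:(lra) ltac:(lra) ltac:(lra).
  apply: (le_trans H); rewrite mulrDl.
  set V := _ / (r - _).
  have V0 : 0 <= V by rewrite divr_ge0 ?enorm_ge0 // ltW.
  (* Two points of the small ball are at most [2 * lam * rho] apart, and at least [tau / 2] has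
     elapsed. *)
  have VW : V <= 4 * lam * rho / tau.
    rewrite ler_pdivrMr // mulrAC ler_pdivlMr //.
    have := enorm_trans x y x1; rewrite [enorm (x - x1)]enormC.
    move=> yx1; apply: (@le_trans _ _ (2 * (lam * rho) * tau)).
      by rewrite ler_wpM2r ?ltW //; lra.
    have := ler_wpM2l (ltW lr0) gap; lra.
  have V1 := line_cost_ge0 p A V V0.
  have V2 := ler_line_cost _ _ _ _ p1 A0 V0 VW.
  have gap1 : r - (t - tau) <= tau by lra.
  have B1 : line_cost p A V * (r - (t - tau)) <= w / 8.
    apply: le_trans c2; apply: ler_pM => //; lra.
  have B2 : 2 * A * (r - (t - tau)) <= kap * w / 8.
    by apply: le_trans c1; rewrite ler_wpM2l // mulr_ge0 // ltW.
  lra.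
exists (m + kap * w / 2) => y r yr /andP[tr rt].
have yr' : enorm (y - x) <= lam * rho by rewrite (le_trans yr) //; lra.
have /andP[_ ule] : m <= u (y, r) <= m + w by apply: um; [lra|apply/andP; split; lra].
apply/andP; split; last by lra.
have := lower_barrier p A u x (lam * rho) (t - tau) t m (kap * w) y r
  (lt_trans ltr01 p1) A0 usup.
move=> H; apply: le_trans (H _ _ _ _ _ _ _ _ _) => //; try lra.
(* In the half ball the paraboloid loses at most a quarter of [kap * w]; the two sinking terms lose
   an eighth each during the first half and a quarter in total. *)
- have q1 : (enorm (y - x) / (lam * rho)) ^+ 2 <= 4^-1.
    rewrite (_ : 4^-1 = 2^-1 ^+ 2); last by field.
    apply: lerXn2r; rewrite ?nnegrE ?divr_ge0 ?enorm_ge0 ?invr_ge0 //.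
      exact: ltW.
    rewrite ler_pdivrMr //; lra.
  have := ler_wpM2l (ltW kw0) q1.
  set P := A * _ in c3 *.
  have P0 : 0 <= P by rewrite mulr_ge0 ?powR_ge0 // ltW.
  have : (P + 2 * A) * (r - (t - tau)) <= (P + 2 * A) * tau.
    by apply: ler_wpM2l; lra.
  lra.
- by move=> z r' zr zr'; have /andP[] := um z r' ltac:(lra) zr'.
- move=> z zr; rewrite leNgt; apply/negP => uz; apply: high; exists z; split => //.
  lra.
Qed.

End oscillation.

(** First [lam] is taken small in terms of [A] and [p], then [kap] in terms of [lam]. These are the
    smallness conditions of one step once the intrinsic height has removed the size of the
    cylinder. *)
Lemma scale_parameters {R : realType} (p A : R) : 1 < p -> 0 < A ->
  exists lam kap : R, [/\ 0 < lam <= 4^-1, 0 < kap <= 2^-1,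
    A `^ (p - 1)^-1 * (4 * lam) <= 8^-1 &
    A * (2 / lam) `^ p * kap `^ (p - 1) <= 8^-1].
Proof.
move=> p1 A0; have p0 : 0 < p - 1 by lra.
have a0 : 0 < A `^ (p - 1)^-1 by exact: powR_gt0.
pose lam := Num.min 4^-1 (32 * A `^ (p - 1)^-1)^-1.
have lam0 : 0 < lam by rewrite lt_min !invr_gt0 mulr_gt0 // ltr0n.
have b0 : 0 < A * (2 / lam) `^ p by rewrite mulr_gt0 ?powR_gt0 ?divr_gt0.
pose c := (8 * (A * (2 / lam) `^ p))^-1.
have c0 : 0 < c by rewrite invr_gt0 mulr_gt0.
pose kap := Num.min 2^-1 (c `^ (p - 1)^-1).
have kap0 : 0 < kap by rewrite lt_min invr_gt0 ltr0n powR_gt0.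
exists lam, kap; split.
- by rewrite lam0 ge_min lexx.
- by rewrite kap0 ge_min lexx.
- have : lam <= (32 * A `^ (p - 1)^-1)^-1 by rewrite ge_min lexx orbT.
  move=> /(ler_wpM2l (ltW a0)).
  rewrite invfM mulrCA divff ?gt_eqF // mulr1 => h.
  by rewrite mulrCA; lra.
- have kc : kap `^ (p - 1) <= c.
    have -> : c = (c `^ (p - 1)^-1) `^ (p - 1).
      by rewrite -powRrM mulVf ?gt_eqF // powRr1 // ltW.
    apply: ge0_ler_powR; rewrite ?nnegrE ?powR_ge0 ?(ltW kap0) ?(ltW p0) //.
    by rewrite ge_min lexx orbT.
  move: kc; rewrite /c invfM => /(ler_wpM2l (ltW b0)).
  by rewrite mulrCA divff ?gt_eqF // mulr1.
Qed.

(** A base of at least one only grows under the power [p]. Hence heights shrink at least as fast as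
    radii in the iteration. *)
Lemma time_ratio_le {R : realType} (p mu sigma : R) : 1 < p -> 0 < mu ->
  mu <= sigma -> sigma / (sigma / mu) `^ p <= mu.
Proof.
move=> p1 mu0 ms; have s0 := lt_le_trans mu0 ms.
have q1 : 1 <= sigma / mu by rewrite ler_pdivlMr // mul1r.
have q0 : 0 < sigma / mu by rewrite divr_gt0.
rewrite ler_pdivrMr ?powR_gt0 //.
have := ler_wpM2l (ltW mu0) (le1r_powR q1 (ltW p1)).
by rewrite mulrCA divff ?gt_eqF // mulr1.
Qed.

(** * Intrinsic scaling and iteration *)

Section scaling.
Context {R : realType} {d : nat} (p A : R).
Implicit Types (u : 'rV[R]_d * R -> R) (x y : 'rV[R]_d)
  (s t r m rho w tau lam kap M X : R).

Local Notation Q := (@cylinder R d 1 0 1).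
Local Notation subsol u := (gradient_subsolution (lower_hamiltonian p A) u).
Local Notation supersol u := (gradient_subsolution
  (fun xi => - upper_hamiltonian p A xi) (fun z => - u z)).

Lemma confined_sub u x t rho tau w rho' tau' : rho' <= rho -> tau' <= tau ->
  confined u x t rho tau w -> confined u x t rho' tau' w.
Proof.
move=> rr tt [m um]; exists m => y r yr /andP[tr rt].
by apply: um; [exact: le_trans rr|rewrite rt andbT; lra].
Qed.

(* [X] is the slope [w / rho]; the height [rho * X / X `^ p] is the intrinsic
   one, [rho `^ p / w `^ (p - 1)]. *)
Lemma confined_improve_scaled u M x t rho X lam kap :
  1 < p -> 0 < A -> subsol u -> supersol u ->
  (forall z, Q z -> `|u z| <= M) ->
  enorm x + rho < 1 -> 0 < rho -> 0 < X -> rho * X / X `^ p <= t -> t <= 1 ->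
  0 < lam <= 4^-1 -> 0 < kap <= 2^-1 ->
  16 * A <= kap * X `^ p ->
  A `^ (p - 1)^-1 * (4 * lam) <= 8^-1 ->
  A * (2 / lam) `^ p * kap `^ (p - 1) <= 8^-1 ->
  confined u x t rho (rho * X / X `^ p) (rho * X) ->
  confined u x t (lam / 2 * rho) (rho * X / X `^ p / 2)
    ((1 - kap / 2) * (rho * X)).
Proof.
move=> p1 A0 usub usup uM xr rho0 X0 taut t1 /andP[lam0 lam4] /andP[kap0 kap2]
  h1 h2 h3.
have Xp0 : 0 < X `^ p by exact: powR_gt0.
have w0 : 0 < rho * X by exact: mulr_gt0.
have p0 : 0 < p - 1 by lra.
have XpE : X `^ p = X * X `^ (p - 1) by rewrite mulr_powRB1 ?ltW //; lra.
apply: (confined_improve p A u M x t rho _ _ lam kap p1 A0 usub usup uM xr rho0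
  _ taut t1 w0).
- by rewrite divr_gt0.
- by apply/andP; split; lra.
- by apply/andP; split; lra.
- rewrite mulrA ler_pdivrMr //.
  have := ler_wpM2r (ltW w0) h1; lra.
- have -> : 4 * lam * rho / (rho * X / X `^ p) = 4 * lam * X `^ (p - 1).
    by rewrite XpE; field; rewrite !gt_eqF // powR_gt0.
  have -> : line_cost p A (4 * lam * X `^ (p - 1)) =
      4 * lam * A `^ (p - 1)^-1 * (4 * lam) `^ (p - 1)^-1 * X `^ p.
    rewrite /line_cost !powRM ?mulr_ge0 ?powR_ge0 ?(ltW A0) ?(ltW lam0) //.
    rewrite -[(X `^ (p - 1)) `^ _]powRrM divff ?gt_eqF // powRr1 ?ltW // XpE.
    ring.
  have l1 : (4 * lam) `^ (p - 1)^-1 <= 1.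
    rewrite [leRHS](_ : 1 = 1 `^ (p - 1)^-1); last by rewrite powR1.
    apply: ge0_ler_powR; rewrite ?nnegrE ?invr_ge0; lra.
  have la0 : 0 <= 4 * lam * A `^ (p - 1)^-1.
    by rewrite !mulr_ge0 ?powR_ge0 // ltW.
  have := ler_wpM2l la0 l1; rewrite mulr1 => l2.
  have -> (a : R) : a * X `^ p * (rho * X / X `^ p) = a * (rho * X).
    by field; rewrite gt_eqF.
  have : 4 * lam * A `^ (p - 1)^-1 * (4 * lam) `^ (p - 1)^-1 <= 8^-1.
    by apply: le_trans l2 _; rewrite mulrC.
  by move=> /(ler_wpM2r (ltW w0)); lra.
- have -> : 2 * (kap * (rho * X)) / (lam * rho) = 2 / lam * kap * X.
    by field; rewrite !gt_eqF.
  have l0 : 0 <= 2 / lam by rewrite divr_ge0 // ltW.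
  rewrite powRM ?(ltW X0) ?(mulr_ge0 l0 (ltW kap0)) //.
  rewrite powRM ?(ltW kap0) //.
  have -> (a b : R) : A * (a * b * X `^ p) * (rho * X / X `^ p) =
      A * a * b * (rho * X) by field; rewrite gt_eqF.
  (* One factor [kap] is kept to match the right side; the remaining power is the one made small by
     the choice of [kap]. *)
  have -> : kap `^ p = kap `^ (p - 1) * kap.
    by rewrite mulrC mulr_powRB1 ?ltW //; lra.
  rewrite !mulrA.
  have := ler_wpM2r (ltW (mulr_gt0 kap0 w0)) h3; lra.
Qed.

(** Induction with [rho] and [X] general: a step turns them into [rho * mu] and [X * (sigma / mu)].
    The slope does not decrease, so the condition absorbing the zero order terms persists. *)
Lemma confined_iter u M x t lam kap k : 1 < p -> 0 < A ->
  subsol u -> supersol u -> (forall z, Q z -> `|u z| <= M) ->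
  0 < lam <= 4^-1 -> 0 < kap <= 2^-1 ->
  A `^ (p - 1)^-1 * (4 * lam) <= 8^-1 ->
  A * (2 / lam) `^ p * kap `^ (p - 1) <= 8^-1 ->
  t <= 1 ->
  let mu := lam / 2 in let sigma := 1 - kap / 2 in
  let beta := sigma / (sigma / mu) `^ p in
  forall rho X, enorm x + rho < 1 -> 0 < rho -> 0 < X ->
  rho * X / X `^ p <= t -> 16 * A <= kap * X `^ p ->
  confined u x t rho (rho * X / X `^ p) (rho * X) ->
  confined u x t (rho * mu ^+ k) (rho * X / X `^ p * beta ^+ k)
    (rho * X * sigma ^+ k).
Proof.
move=> p1 A0 usub usup uM lamb kapb h2 h3 t1 mu sigma beta.
have [lam0 lam4] := andP lamb; have [kap0 kap2] := andP kapb.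
have mu0 : 0 < mu by rewrite /mu; lra.
have sigma0 : 0 < sigma by rewrite /sigma; lra.
have q1 : 1 <= sigma / mu by rewrite ler_pdivlMr // /sigma /mu; lra.
have q0 : 0 < sigma / mu by lra.
have qp : sigma / mu <= (sigma / mu) `^ p by apply: le1r_powR => //; lra.
have beta_mu : beta <= mu by apply: time_ratio_le => //; rewrite /sigma /mu; lra.
have beta2 : beta <= 2^-1 by rewrite (le_trans beta_mu) // /mu; lra.
elim: k => [|k IHk] rho X xr rho0 X0 taut h1 conf; first by rewrite !expr0 !mulr1.
have Xp0 : 0 < X `^ p by exact: powR_gt0.
have tau0 : 0 < rho * X / X `^ p by rewrite divr_gt0 ?mulr_gt0.
have tauE : rho * mu * (X * (sigma / mu)) / (X * (sigma / mu)) `^ p =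
    rho * X / X `^ p * beta.
  rewrite powRM ?ltW // /beta; field.
  by rewrite !gt_eqF // powR_gt0.
have wE : rho * mu * (X * (sigma / mu)) = rho * X * sigma.
  by field; rewrite gt_eqF.
have := IHk (rho * mu) (X * (sigma / mu)).
rewrite tauE wE.
have powS (a b : R) : a * b ^+ k.+1 = a * b * b ^+ k by rewrite exprS mulrA.
rewrite !powS; apply.
- have := ler_wpM2l (ltW rho0) (_ : mu <= 1); rewrite /mu; lra.
- exact: mulr_gt0.
- exact: mulr_gt0.
- apply: le_trans taut; rewrite ger_pMr //; lra.
- apply: le_trans h1 _; rewrite powRM ?(ltW X0) ?(ltW q0) // mulrA.
  by rewrite ler_peMr ?(le_trans q1 qp) // mulr_ge0 ?(ltW kap0) ?(ltW Xp0).
- have := confined_improve_scaled _ _ _ _ _ _ _ _ p1 A0 usub usup uM xr rho0 X0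
    taut t1 lamb kapb h1 h2 h3 conf.
  (* The step gives half the old height; as [beta <= 2^-1], this contains the intrinsic cylinder of
     the new pair. *)
  rewrite -/mu -/sigma [sigma * _]mulrC [mu * _]mulrC; apply: confined_sub => //.
  by rewrite ler_wpM2l // ltW.
Qed.

End scaling.

(** * From viscosity solutions to the Hoelder estimate *)

Section viscosity.
Context {R : realType} {d : nat} (p A : R).
Implicit Types (H : 'rV[R]_d -> R -> 'rV[R]_d -> R) (u : 'rV[R]_d * R -> R).

Local Notation Q := (@cylinder R d 1 0 1).

Lemma subsolution_lower_hamiltonian H u :
  (forall x t q, Q (x, t) -> A^-1 * enorm q `^ p - A <= H x t q) ->
  viscosity_subsolution H Q u ->
  gradient_subsolution (lower_hamiltonian p A) u.
Proof.
move=> lowH [cu usub]; split => // phi [x t] ephi Qz umax.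
apply: le_trans (usub phi (x, t) (elementary_smooth _ ephi) Qz umax).
by rewrite lerD2l; apply: lowH; exact: interior_subset Qz.
Qed.

(** A test function [phi] touching [- u] from above gives [- phi] touching [u] from below, and the
    bound is even in the gradient. *)
Lemma supersolution_upper_hamiltonian H u :
  (forall x t q, Q (x, t) -> H x t q <= A * enorm q `^ p + A) ->
  viscosity_supersolution H Q u ->
  gradient_subsolution (fun xi => - upper_hamiltonian p A xi) (fun z => - u z).
Proof.
move=> uppH [cu usup]; split.
  by move=> z; apply: (@continuousN R R^o (subspace Q) u z (cu z)).
move=> phi [x t] ephi Qz umax.
have dphi v : 'D_v (- phi) (x, t) = - 'D_v phi (x, t).
  by apply: deriveN; exact/diff_derivable/elementary_differentiable.
have umin : local_min_at Q (fun z => u z - (- phi) z) (x, t).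
  by apply: filterS umax => z + Qz' => /(_ Qz'); rewrite !fctE; lra.
have := usup _ _ (elementary_smooth _ (elementary_opp _ ephi)) Qz umin.
have -> : Dx (- phi) (x, t) = - Dx phi (x, t).
  by apply/rowP => i; rewrite !mxE dphi.
have := uppH x t (- Dx phi (x, t)) (interior_subset Qz).
rewrite /Dt dphi enormN /upper_hamiltonian /=; lra.
Qed.

End viscosity.

(** * Geometric decay implies a Hoelder bound *)

Lemma expr_archimedean {R : realType} (b e : R) : 0 < b -> b < 1 -> 0 < e ->
  exists n, b ^+ n < e.
Proof.
move=> b0 b1 e0.
have := @cvg_expr R b; rewrite gtr0_norm // => /(_ b1) cb.
have : \forall n \near \oo, b ^+ n < e by exact: (cvgr_lt _ cb).
by case=> n _ hn; exists n; apply: hn => /=.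
Qed.

Section hoelder.
Context {R : realType} {d : nat}.
Implicit Types (z w : 'rV[R]_d * R) (u : 'rV[R]_d * R -> R).

(* [edist] alone would denote the extended distance of MathComp-Analysis. *)
Lemma enorm_le_edist z w : enorm (z.1 - w.1) <= Defs.edist z w.
Proof.
by rewrite -[leLHS]ger0_norm ?enorm_ge0 // -sqrtr_sqr ler_wsqrtr // lerDl sqr_ge0.
Qed.

Lemma time_le_edist z w : `|z.2 - w.2| <= Defs.edist z w.
Proof. by rewrite -sqrtr_sqr ler_wsqrtr // lerDr sqr_ge0. Qed.

Lemma edistC z w : Defs.edist z w = Defs.edist w z.
Proof. by rewrite /Defs.edist enormC -[(z.2 - w.2) ^+ 2]sqrrN opprB. Qed.

Lemma edist_gt0 z w : z != w -> 0 < Defs.edist z w.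
Proof.
move=> zw; rewrite lt_neqAle sqrtr_ge0 andbT eq_sym; apply/eqP => e0.
move: zw; apply/negP/negPn/eqP.
case: z w e0 => [x t] [y s] e0; congr pair.
  have := enorm_le_edist (x, t) (y, s); rewrite e0 /= => h.
  apply/eqP; rewrite -subr_eq0; apply/eqP/enorm_eq0/eqP.
  by rewrite eq_le h enorm_ge0.
have := time_le_edist (x, t) (y, s); rewrite e0 /= normr_le0 subr_eq0.
by move=> /eqP.
Qed.

Lemma hoelder_of_geometric_decay u (Q : set ('rV[R]_d * R)) (w0 D sigma beta : R) :
  0 < D -> 0 < beta -> beta < sigma -> sigma < 1 ->
  (forall z w, Q z -> Q w -> `|u z - u w| <= w0) ->
  (forall z w k, Q z -> Q w -> Defs.edist z w <= D * beta ^+ k ->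
     `|u z - u w| <= w0 * sigma ^+ k) ->
  (holder_seminorm (ln sigma / ln beta) Q u <=
     (w0 / sigma / D `^ (ln sigma / ln beta))%:E)%E.
Proof.
move=> D0 b0 bs s1 bound decay; set alpha := ln sigma / ln beta.
have s0 : 0 < sigma by exact: lt_trans bs.
have lnb : ln beta < 0 by rewrite ln_lt0 // b0 (lt_trans bs).
have lns : ln sigma < 0 by rewrite ln_lt0 // s0.
have alpha0 : 0 <= alpha by rewrite ltW // nmulr_lgt0 // invr_lt0.
have balpha k : (beta ^+ k) `^ alpha = sigma ^+ k.
  rewrite -powR_mulrn ?(ltW b0) // -powRrM mulrC powRrM.
  have -> : beta `^ alpha = sigma.
    by rewrite /powR gt_eqF // /alpha divfK ?lt_eqF // lnK.
  by rewrite powR_mulrn // ltW.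
apply: ge_ereal_sup => _ [[z w] /= [Qz Qw zw] <-].
rewrite lee_fin ler_pdivrMr; last by rewrite powR_gt0 // edist_gt0.
have delta0 := edist_gt0 _ _ zw.
have w00 : 0 <= w0 by exact: le_trans (bound z w Qz Qw).
set delta := Defs.edist z w in delta0 *.
have [n0 Hn0] := expr_archimedean _ _ b0 (lt_trans bs s1) (divr_gt0 delta0 D0).
have ex : exists n, D * beta ^+ n <= delta.
  by exists n0; rewrite mulrC -ler_pdivlMr // ltW.
have kP : exists2 k, sigma ^+ k <= (delta / D) `^ alpha &
    `|u z - u w| <= w0 / sigma * sigma ^+ k.
  (* For the least [k] with [D * beta ^+ k <= delta], decay applies at the preceding scale; for
     [k = 0] the global bound suffices. *)
  case: (ex_minnP ex) => -[|k] hk kmin.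
    exists 0%N.
      rewrite -(balpha 0%N) expr0; apply: ge0_ler_powR; rewrite ?nnegrE //.
        by rewrite divr_ge0 // ltW.
      by rewrite ler_pdivlMr // mul1r -[D]mulr1 -(expr0 beta).
    apply: (le_trans (bound z w Qz Qw)).
    by rewrite expr0 mulr1 ler_pdivlMr // ler_piMr // ltW.
  exists k.+1.
    rewrite -balpha; apply: ge0_ler_powR; rewrite ?nnegrE //.
    - by rewrite exprn_ge0 // ltW.
    - by rewrite divr_ge0 // ltW.
    - by rewrite ler_pdivlMr // mulrC.
  rewrite exprS mulrA divfK ?gt_eqF //; apply: decay => //.
  rewrite leNgt; apply/negP => /ltW /kmin; by rewrite ltnn.
case: kP => k k1 k2; apply: (le_trans k2).
rewrite -[leRHS]mulrA ler_wpM2l ?divr_ge0 ?(ltW s0) //.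
apply: (le_trans k1).
rewrite powRM ?(ltW delta0) ?invr_ge0 ?(ltW D0) // mulrC.
by rewrite -powR_inv1 ?(ltW D0) // powRAC powR_inv1 ?powR_ge0.
Qed.

End hoelder.

(** All constants are fixed before [u], which makes the estimate uniform. *)
Lemma oscillation_decay {R : realType} (d : nat) (p A M : R) :
  1 < p -> 0 < A ->
  exists w0 D sigma beta : R,
  [/\ 2 * `|M| <= w0, 0 < D, 0 < beta, beta < sigma & sigma < 1] /\
  forall u : 'rV[R]_d * R -> R,
    gradient_subsolution (lower_hamiltonian p A) u ->
    gradient_subsolution (fun xi => - upper_hamiltonian p A xi)
      (fun z => - u z) ->
    (forall z, cylinder d 1 0 1 z -> `|u z| <= M) ->
    forall z w k, cylinder d 2^-1 2^-1 1 z -> cylinder d 2^-1 2^-1 1 w ->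
      Defs.edist z w <= D * beta ^+ k -> `|u z - u w| <= w0 * sigma ^+ k.
Proof.
move=> p1 A0.
have [lam [kap [lamb kapb h2 h3]]] := scale_parameters _ _ p1 A0.
have [lam0 lam4] := andP lamb; have [kap0 kap2] := andP kapb.
have M0 := normr_ge0 M.
have Ak0 : 0 < A / kap by rewrite divr_gt0.
(* The first term bounds the initial oscillation, the second ensures [X >= 1], and the third gives
   [X >= 16 * A / kap], which starts the iteration. *)
pose w0 := 2 * `|M| + 1 + 4 * (A / kap).
pose X := 4 * w0.
pose rho : R := 4^-1.
have w01 : 1 <= w0 by rewrite /w0; lra.
have X1 : 1 <= X by rewrite /X; lra.
have rX : rho * X = w0 by rewrite /rho /X; field.
have XXp : X <= X `^ p by apply: le1r_powR => //; exact: ltW.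
have Xp0 : 0 < X `^ p by lra.
pose tau := w0 / X `^ p.
have tau0 : 0 < tau by rewrite divr_gt0 //; lra.
have tau4 : tau <= 4^-1 by rewrite ler_pdivrMr //; rewrite /X in XXp *; lra.
pose mu := lam / 2.
pose sigma := 1 - kap / 2.
pose beta := sigma / (sigma / mu) `^ p.
have mu0 : 0 < mu by rewrite /mu; lra.
have s0 : 0 < sigma by rewrite /sigma; lra.
have s1 : sigma < 1 by rewrite /sigma; lra.
have beta0 : 0 < beta by rewrite divr_gt0 // powR_gt0 // divr_gt0.
have beta_mu : beta <= mu.
  by apply: time_ratio_le => //; rewrite /sigma /mu; lra.
(* As [beta <= mu], the distance [D * beta ^+ k] fits within both the radius and the height of the
   cylinder at step [k]. *)
pose D := Num.min rho tau.
have D0 : 0 < D by rewrite lt_min tau0 /rho invr_gt0 ltr0n.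
exists w0, D, sigma, beta; split.
  split=> //; first by rewrite /w0; lra.
  by apply: le_lt_trans beta_mu _; rewrite /mu /sigma; lra.
move=> u usub usup uM z w k Qz Qw.
(* Cylinders extend backwards in time, so the later point serves as top centre. *)
wlog zw : z w Qz Qw / w.2 <= z.2.
  move=> H; have [|/ltW] := leP w.2 z.2; first exact: H.
  by rewrite distrC edistC; exact: H.
case: z w Qz Qw zw => [x t] [y r] [/= xh]; rewrite in_itv /= => /andP[t2 t1].
move=> [/= yh]; rewrite in_itv /= => /andP[r2 r1] rt dist.
have h1 : 16 * A <= kap * X `^ p.
  have : 16 * (A / kap) <= X `^ p by rewrite /X /w0 in XXp *; lra.
  move=> /(ler_wpM2l (ltW kap0)).
  by have -> : kap * (16 * (A / kap)) = 16 * A by field; rewrite gt_eqF.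
have init : confined u x t rho (rho * X / X `^ p) (rho * X).
  exists (- M) => y' r' y'x /andP[tr' r't].
  have : `|u (y', r')| <= M.
    apply: uM; split => /=.
      have := enorm_trans x y' 0; rewrite !subr0 /eball /=.
      by move: xh; rewrite /eball /= /rho in y'x *; lra.
    by move: tr'; rewrite in_itv /= rX -/tau => ?; apply/andP; split; lra.
  rewrite ler_norml rX => /andP[ul uu]; rewrite ul /=.
  by have := ler_norm M; rewrite /w0; lra.
have xr : enorm x + rho < 1 by move: xh; rewrite /eball /= /rho; lra.
have [m um] := confined_iter p A u M x t lam kap k p1 A0 usub usup uM lamb kapb
  h2 h3 t1 rho X xr ltac:(by rewrite /rho; lra) ltac:(lra)
  ltac:(by rewrite rX -/tau; lra) h1 init.
move: um; rewrite rX -/tau -/mu -/sigma -/beta => um.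
have muk : 0 < mu ^+ k by rewrite exprn_gt0.
have bk : 0 < beta ^+ k by rewrite exprn_gt0.
have Drho : D * beta ^+ k <= rho * mu ^+ k.
  apply: ler_pM; rewrite ?(ltW D0) ?(ltW bk) ?ge_min ?lexx //.
  by apply: lerXn2r; rewrite ?nnegrE ?(ltW beta0) ?(ltW mu0).
have Dtau : D * beta ^+ k <= tau * beta ^+ k.
  by rewrite ler_wpM2r ?(ltW bk) // ge_min lexx orbT.
have dx := enorm_le_edist (x, t) (y, r).
have dt := time_le_edist (x, t) (y, r).
rewrite /= in dx dt; rewrite ger0_norm ?subr_ge0 // in dt.
have /andP[lx ux] : m <= u (x, t) <= m + w0 * sigma ^+ k.
  apply: um; first by rewrite subrr enorm0 mulr_ge0 ?(ltW muk) // invr_ge0.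
  by apply/andP; split => //; have := mulr_gt0 tau0 bk; lra.
have /andP[ly uy] : m <= u (y, r) <= m + w0 * sigma ^+ k.
  by apply: um; [rewrite enormC; lra|apply/andP; split; lra].
by rewrite ler_norml; apply/andP; split; lra.
Qed.

Lemma sup_norm_le {R : realType} {T : Type} (Q : set T) (u : T -> R) (M : R) :
  (sup_norm Q u <= M%:E)%E <-> forall z, Q z -> `|u z| <= M.
Proof.
split=> [/ereal_supP H z Qz|H].
  by rewrite -lee_fin; apply: H; exists z.
by apply: ge_ereal_sup => _ [z Qz <-]; rewrite lee_fin H.
Qed.

Theorem theorem1p1 (R : realType) (d : nat) (p A M : R) :
  (0 < d)%N -> 1 < p -> 0 < A ->
  exists alpha C : R, [/\ 0 < alpha, alpha < 1 &
    forall (H : 'rV[R]_d -> R -> 'rV[R]_d -> R) (u : 'rV[R]_d * R -> R),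
      (forall (x : 'rV[R]_d) (t : R) (q : 'rV[R]_d),
        cylinder d 1 0 1 (x, t) ->
        A^-1 * enorm q `^ p - A <= H x t q /\
        H x t q <= A * enorm q `^ p + A) ->
      {within cylinder d 1 0 1, continuous u} ->
      (sup_norm (cylinder d 1 0 1) u <= M%:E)%E ->
      viscosity_solution H (cylinder d 1 0 1) u ->
      (holder_norm alpha (cylinder d 2^-1 2^-1 1) u <= C%:E)%E].
Proof.
move=> _ p1 A0.
have [w0 [D [sigma [beta [[Mw D0 b0 bs s1] decay]]]]] :=
  oscillation_decay d p A M p1 A0.
have s0 : 0 < sigma by exact: lt_trans bs.
have lnb : ln beta < 0 by rewrite ln_lt0 // b0 (lt_trans bs).
have lns : ln sigma < 0 by rewrite ln_lt0 // s0.
pose alpha := ln sigma / ln beta.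
exists alpha, (M + w0 / sigma / D `^ alpha); split.
- by rewrite nmulr_lgt0 // invr_lt0.
(* Both logarithms are negative and [beta < sigma], so their ratio is below one. *)
- by rewrite /alpha ltr_ndivrMr // mul1r ltr_ln ?posrE.
move=> H u Hbnd _ /sup_norm_le uM [usub usup].
have sub z : cylinder d 2^-1 2^-1 1 z -> cylinder d 1 0 1 z.
  case: z => x t [/= xh]; rewrite in_itv /= => /andP[t2 t1].
  by split; rewrite /eball /= ?in_itv /= in xh *; [lra|apply/andP; split; lra].
rewrite /holder_norm EFinD; apply: leeD.
  by apply/sup_norm_le => z /sub; exact: uM.
apply: hoelder_of_geometric_decay => //.
  move=> z w /sub/uM Mz /sub/uM Mw'.
  have := ler_norm M; have := ler_normB (u z) (u w); lra.
apply: decay => //.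
- by apply: subsolution_lower_hamiltonian usub => x t q /Hbnd-/(_ q)[].
- by apply: supersolution_upper_hamiltonian usup => x t q /Hbnd-/(_ q)[].
Qed.
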